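(* Let $C \ge 2$ be a real number. Let $n, A, B, a_1, a_2, b_1, b_2$ be positive integers such that $$n = AB = (A + a_1)(B - b_1) = (A + a_2)(B - b_2)$$ with $1 \le a_1 < a_2 \le C$ and $1 \le b_1 < b_2 \le C$. Then $A < C^3$ and $B < C^3$. *)

(* Defs.v *)
From Stdlib Require Export ZArith Reals.

(* Main.v *)
Require Import Defs.
From Stdlib Require Import ZArith Reals Lia Lra.

(** Each equation [A * B = (A + a) * (B - b)] is really linear in [A] and [B]:
    it says [a * B - b * A = a * b].  The two equations therefore form a linear
    system, with determinant [D = a2 * b1 - a1 * b2] up to sign, and Cramer's
    rule gives
    [A * D = a1 * a2 * (b2 - b1)] and [B * D = b1 * b2 * (a2 - a1)].
    Both right-hand sides are positive, so the integer [D] is at least [1], and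
    [A] and [B] are bounded by these right-hand sides
    ([le_of_mul_pos_eq]).  Each of those is a product of three nonnegative
    numbers at most [C], and the factor [b2 - b1] or [a2 - a1] is strictly less
    than [C]; hence the strict bound [C ^ 3] ([prod3_lt_cube]). *)

(** Integrality enters the argument here: a positive integer [D] is at
    least [1], so dividing by it cannot increase [P]. *)
Lemma le_of_mul_pos_eq (X D P : Z) :
  (0 < X)%Z -> (0 < P)%Z -> (X * D = P)%Z -> (X <= P)%Z.
Proof.
  intros HX HP HXD.
  assert (HD : (0 < D)%Z) by (apply (Z.mul_pos_cancel_l X); lia).
  rewrite <- HXD.
  apply Z.le_mul_diag_r; lia.
Qed.

Lemma prod3_lt_cube (C x y z : R) :
  (0 < C)%R -> (0 <= x <= C)%R -> (0 <= y <= C)%R -> (0 <= z < C)%R ->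
  (x * y * z < C ^ 3)%R.
Proof.
  intros HC [Hx HxC] [Hy HyC] [Hz HzC].
  assert (Hxy : (x * y <= C * C)%R) by (apply Rmult_le_compat; assumption).
  apply Rle_lt_trans with (C * C * z)%R.
  - apply Rmult_le_compat_r; assumption.
  - replace (C ^ 3)%R with (C * C * C)%R by ring.
    apply Rmult_lt_compat_l; [apply Rmult_lt_0_compat |]; assumption.
Qed.

(** The two preceding bounds combined, in the shape in which Cramer's rule
    delivers each of the two unknowns. *)
Lemma cramer_quotient_lt_cube (C : R) (X D u1 u2 v1 v2 : Z) :
  (0 < X)%Z -> (0 < u1 < u2)%Z -> (0 < v1 < v2)%Z ->
  (IZR u2 <= C)%R -> (IZR v2 <= C)%R ->
  (X * D = u1 * u2 * (v2 - v1))%Z -> (IZR X < C ^ 3)%R.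
Proof.
  intros HX [Hu1 Hu] [Hv1 Hv] HuC HvC HXD.
  assert (HXP : (X <= u1 * u2 * (v2 - v1))%Z).
  { apply (le_of_mul_pos_eq X D); [assumption | | assumption].
    apply Z.mul_pos_pos; [apply Z.mul_pos_pos |]; lia. }
  apply IZR_le in HXP.
  rewrite !mult_IZR, minus_IZR in HXP.
  apply IZR_lt in Hu1, Hu, Hv1, Hv.
  apply Rle_lt_trans with (1 := HXP).
  apply prod3_lt_cube; lra.
Qed.

Theorem theorem1 (C : R) (n A B a1 a2 b1 b2 : Z)
    (hC : (2 <= C)%R)
    (hn : (0 < n)%Z) (hA : (0 < A)%Z) (hB : (0 < B)%Z)
    (ha1 : (0 < a1)%Z) (ha2 : (0 < a2)%Z)
    (hb1 : (0 < b1)%Z) (hb2 : (0 < b2)%Z)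
    (hn0 : n = (A * B)%Z)
    (hn1 : n = ((A + a1) * (B - b1))%Z)
    (hn2 : n = ((A + a2) * (B - b2))%Z)
    (ha : (1 <= a1)%Z /\ (a1 < a2)%Z /\ (IZR a2 <= C)%R)
    (hb : (1 <= b1)%Z /\ (b1 < b2)%Z /\ (IZR b2 <= C)%R) :
  (IZR A < C ^ 3)%R /\ (IZR B < C ^ 3)%R.
Proof.
  destruct ha as [_ [Ha HaC]], hb as [_ [Hb HbC]].
  assert (E1 : (a1 * B = b1 * A + a1 * b1)%Z) by lia.
  assert (E2 : (a2 * B = b2 * A + a2 * b2)%Z) by lia.
  split.
  - apply (cramer_quotient_lt_cube C A (a2 * b1 - a1 * b2) a1 a2 b1 b2);
      try lia; try assumption.
    (* Eliminate B: a2 times the first equation minus a1 times the second. *)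
    assert (F1 := f_equal (Z.mul a2) E1).
    assert (F2 := f_equal (Z.mul a1) E2).
    lia.
  - apply (cramer_quotient_lt_cube C B (a2 * b1 - a1 * b2) b1 b2 a1 a2);
      try lia; try assumption.
    (* Eliminate A: b2 times the first equation minus b1 times the second. *)
    assert (F1 := f_equal (Z.mul b2) E1).
    assert (F2 := f_equal (Z.mul b1) E2).
    lia.
Qed.
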